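(* Let $G$ be a finite simple connected graph with $n(G)$ vertices and $m(G)$ edges. Then the minimum degree of its spanning tree auxiliary graph satisfies \[ \delta(Aux(G))\ge 2\,(m(G)-n(G)+1). \]
   Context: For a finite simple connected graph $G$ on $n$ vertices, the spanning tree auxiliary graph $Aux(G)$ is the graph whose vertices are the spanning trees of $G$, two spanning trees being adjacent if and only if one is obtained from the other by a single unit transformation, i.e. by adding one edge of $G$ not in the tree and deleting a different edge so that the result is again a spanning tree; equivalently, the symmetric difference of their edge sets has exactly two edges (they share exactly $n-2$ of their $n-1$ edges). *)

(* Defs.v *)
From mathcomp Require Import all_boot.

Set Implicit Arguments.
Unset Strict Implicit.
Unset Printing Implicit Defensive.

Record sgraph := SGraph {
  vertex :> finType;
  adj : rel vertex;
  adj_sym : symmetric adj;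
  adj_irrefl : irreflexive adj }.

Section Graph.
Variable G : sgraph.

(* An edge is the two-element set of its ends. *)
Definition edges : {set {set G}} :=
  [set [set p.1; p.2] | p : G * G & adj p.1 p.2].

Definition degree (x : G) : nat := #|[set y | adj x y]|.

(* All degrees are smaller than #|G| when G has a vertex, so the default value
   only matters for the graph without vertices, where it gives 0. *)
Definition min_degree : nat := \big[minn/#|G|]_(x : G) degree x.

(* The graph without vertices is not connected. *)
Definition connected : bool :=
  (0 < #|G|) && [forall x : G, forall y : G, connect (@adj G) x y].

(* A cycle is a duplicate-free closed walk on at least three vertices; bounding
   its length by #|G| loses nothing, see acyclicP. *)
Definition acyclic : bool :=
  [forall k : 'I_#|G|.+1, forall c : k.-tuple G,
    (2 < k) ==> ~~ ucycleb (@adj G) c].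

Lemma acyclicP :
  reflect (forall c : seq G, 2 < size c -> ~ ucycle (@adj G) c) acyclic.
Proof.
apply: (iffP forallP) => [acG c c_gt2 cyc_c | acG k].
  have [_ uniq_c] := andP cyc_c.
  have le_c : size c < #|G|.+1 by rewrite ltnS -(card_uniqP uniq_c) max_card.
  have /forallP/(_ (in_tuple c)) := acG (Ordinal le_c).
  by move/implyP/(_ c_gt2)/negP; apply.
apply/forallP=> c; apply/implyP=> k_gt2; apply/negP; apply: acG.
by rewrite size_tuple.
Qed.

Definition is_tree : bool := connected && acyclic.

End Graph.

Section SpanningSubgraph.
Variables (G : sgraph) (F : {set {set G}}).

Definition sub_adj : rel G := fun x y => (x != y) && ([set x; y] \in F).

Lemma sub_adj_sym : symmetric sub_adj.
Proof. by move=> x y; rewrite /sub_adj eq_sym setUC. Qed.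

Lemma sub_adj_irrefl : irreflexive sub_adj.
Proof. by move=> x; rewrite /sub_adj eqxx. Qed.

Definition spanning_subgraph : sgraph := SGraph sub_adj_sym sub_adj_irrefl.

(* A spanning tree is represented by its edge set. *)
Definition is_spanning_tree : bool :=
  (F \subset edges G) && is_tree spanning_subgraph.

End SpanningSubgraph.

Section AuxiliaryGraph.
Variable G : sgraph.

Definition spanning_tree : finType :=
  {F : {set {set G}} | is_spanning_tree F}.

(* A unit transformation; its result is a spanning tree because S2 is one. *)
Definition aux_adj : rel spanning_tree := fun S1 S2 =>
  [exists e in edges G :\: val S1, exists f in val S1,
    val S2 == (e |: val S1) :\ f].

Lemma aux_adj_sym : symmetric aux_adj.
Proof.
suff sub S1 S2 : aux_adj S1 S2 -> aux_adj S2 S1.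
  by move=> S1 S2; apply/idP/idP; apply: sub.
case/existsP=> e /andP[/setDP[eG eS1] /existsP[f /andP[fS1 /eqP S2E]]].
have [/subsetP sS1 _] := andP (valP S1).
have nef : e != f by apply: contraNneq eS1 => ->.
apply/exists_inP; exists f.
  by rewrite inE S2E !inE eqxx /= sS1.
apply/exists_inP; exists e; first by rewrite S2E !inE eqxx nef.
apply/eqP/setP=> g; rewrite S2E !inE.
case: (eqVneq g e) => [->|_] /=; first by rewrite (negbTE eS1).
by case: (eqVneq g f) => [->|_].
Qed.

Lemma aux_adj_irrefl : irreflexive aux_adj.
Proof.
move=> S; apply/negbTE/negP.
case/existsP=> e /andP[_ /existsP[f /andP[fS /eqP SE]]].
by move: fS; rewrite SE !inE eqxx.
Qed.

Definition Aux : sgraph := SGraph aux_adj_sym aux_adj_irrefl.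

End AuxiliaryGraph.

(* Main.v *)
Require Import Defs.
From mathcomp Require Import all_boot all_order all_algebra.
From mathcomp Require Import zify.
Import Order.TTheory GRing.Theory Num.Theory.
Local Open Scope ring_scope.

(** Fix a spanning tree S and an edge e = {x, y} of G outside S. Adding e to S
    closes a cycle, made of e and of the path of S from x to y. That path has at
    least two edges, because e is not in S; removing its first edge, at x, or its
    last edge, at y, leaves a spanning tree again. So e gives rise to at least two
    neighbours of S in Aux(G), in which e is the only edge outside S
    ([unit_transformations_ge2]). Hence distinct edges e give distinct neighbours,
    and S has at least 2 |E(G) - S| of them ([aux_degree_ge]). The bound follows
    from |S| = n - 1.

    Cycles are handled through one observation: a connected edge set is a tree
    if and only if each of its edges is a bridge ([acyclic_bridge] and
    [bridge_acyclic]), that is, if and only if it is minimal among connected edge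
    sets. Minimal connected sets exist, so every connected edge set contains a
    spanning tree ([spanning_tree_in]); as all spanning trees have n - 1 edges
    ([card_spanning_tree]), a connected set of n - 1 edges is a spanning tree.
    This is how exchanges are recognised as trees: only connectedness has to be
    checked.

    The other tool is [connect_first_step]: a walk leaving x can be
    chosen never to come back to x. It provides both the edges to be removed in
    an exchange and the edge towards a root that pairs each other vertex with an
    edge of the tree when counting edges. *)

Section EdgeSets.
Local Set Implicit Arguments.
Local Unset Strict Implicit.
Local Open Scope nat_scope.
Variable G : sgraph.
Implicit Types (F H : {set {set G}}) (x y a r : G) (e : {set G}).

(** * Connection inside an edge set *)

Lemma sub_adj_mono F H : F \subset H -> subrel (sub_adj F) (sub_adj H).
Proof. by move=> /subsetP sFH x y /andP[xy /sFH xyH]; rewrite /sub_adj xy. Qed.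

Lemma connect_mono F H x y : F \subset H ->
  connect (sub_adj F) x y -> connect (sub_adj H) x y.
Proof.
move=> sFH; apply: connect_sub x y => x y xy.
exact/connect1/(sub_adj_mono sFH).
Qed.

Lemma connect_sub_adj_sym F : connect_sym (sub_adj F).
Proof. by apply: sym_connect_sym; apply: sub_adj_sym. Qed.

Lemma connected_spanningP F :
  reflect (0 < #|G| /\ forall x y, connect (sub_adj F) x y)
          (connected (spanning_subgraph F)).
Proof.
apply: (iffP andP) => -[G_gt0 cF]; split=> //.
  by move=> x y; have /forallP/(_ x)/forallP/(_ y) := cF.
by apply/forallP=> x; apply/forallP=> y; apply: cF.
Qed.

Lemma connected_edges : connected G -> connected (spanning_subgraph (edges G)).
Proof.
case/andP=> G_gt0 /forallP cG; apply/connected_spanningP; split=> // x y.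
apply: connect_sub (forallP (cG x) y) => u v uv; apply: connect1.
apply/andP; split; first by apply: contraTneq uv => ->; rewrite adj_irrefl.
by apply/imsetP; exists (u, v); rewrite ?inE.
Qed.

Lemma edgesP e : e \in edges G -> exists x y, x != y /\ e = [set x; y].
Proof.
case/imsetP=> -[x y] /=; rewrite inE /= => xy ->; exists x, y; split=> //.
by apply: contraTneq xy => ->; rewrite adj_irrefl.
Qed.

Lemma connected_setD1 F x y :
    connected (spanning_subgraph F) ->
    connect (sub_adj (F :\ [set x; y])) x y ->
  connected (spanning_subgraph (F :\ [set x; y])).
Proof.
case/connected_spanningP=> G_gt0 cF cxy.
apply/connected_spanningP; split=> // u v.
apply: connect_sub (cF u v) => {u v} u v /andP[uv uvF].
case: (eqVneq [set u; v] [set x; y]) => [uvE|neq]; last first.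
  by apply: connect1; rewrite /sub_adj uv !inE neq.
have: u \in [set x; y] by rewrite -uvE set21.
have: v \in [set x; y] by rewrite -uvE set22.
by case/set2P=> -> /set2P[] -> //; rewrite connect_sub_adj_sym.
Qed.

(** Follow a duplicate-free walk from x to y: after its first step it avoids x,
    hence every edge at x and not only the first one. *)
Lemma connect_first_step F x y :
    x != y -> connect (sub_adj F) x y ->
  exists2 a, sub_adj F x a & connect (sub_adj [set e in F | x \notin e]) a y.
Proof.
move=> xy /connectP[p0 /shortenP[[|a p] /= pF up _] yE].
  by rewrite yE eqxx in xy.
case/andP: pF => xa pF; exists a => //; apply/connectP; exists p => //.
case/andP: up => xap _ {yE}.
elim: p a pF xap {xa} => //= b p IHp a /andP[/andP[ab abF] pF].
rewrite !inE !negb_or => /and3P[xa xb xp].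
rewrite IHp ?inE ?negb_or ?xb // /sub_adj ab !inE abF negb_or.
by rewrite xa xb.
Qed.

(** * Trees are the connected edge sets all of whose edges are bridges *)

Lemma acyclic_bridge F x y :
    acyclic (spanning_subgraph F) -> sub_adj F x y ->
  ~~ connect (sub_adj (F :\ [set x; y])) x y.
Proof.
move/acyclicP=> acF xy; apply/negP => /connectP[p0 /shortenP[p pF up _] yE].
apply: (acF (x :: p)); last first.
  have {}pF := sub_path (sub_adj_mono (subD1set _ _)) pF.
  by rewrite /ucycle up andbT /= rcons_path pF -yE sub_adj_sym.
case: p pF up yE => [|a [|b p]] //= pF _ yE; move: xy; rewrite yE.
  by rewrite /sub_adj eqxx.
by move: pF; rewrite yE /sub_adj !inE eqxx andbF.
Qed.

(** On a cycle x, y, z, ... the walk from y through z around to x stays off the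
    edge xy: its first edge misses x, all the others miss y. *)
Lemma bridge_acyclic F :
    (forall x y, sub_adj F x y -> ~~ connect (sub_adj (F :\ [set x; y])) x y) ->
  acyclic (spanning_subgraph F).
Proof.
move=> brF; apply/acyclicP=> -[|x [|y [|z s]]] // _ /andP[].
rewrite [cycle _ _]/= => /and3P[xy yz zs].
rewrite [uniq _]/= => /andP[xs /andP[ys _]].
case/negP: (brF x y xy); rewrite connect_sub_adj_sym.
have nyx : y != x by move: xs; rewrite inE eq_sym => /norP[].
have nzx : z != x by move: xs; rewrite !inE [x == z]eq_sym => /norP[_ /norP[]].
have yzF : sub_adj (F :\ [set x; y]) y z.
  case/andP: yz => yz yzF; rewrite /sub_adj yz in_setD1 yzF andbT.
  apply/eqP=> /setP/(_ x); rewrite !inE eqxx /=.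
  by rewrite ![x == _]eq_sym (negPf nyx) (negPf nzx).
apply: (connect_trans (connect1 yzF)); apply/connectP.
exists (rcons s x); last by rewrite last_rcons.
have: y \notin z :: rcons s x.
  by rewrite -rcons_cons mem_rcons inE negb_or nyx.
elim: (rcons s x) z zs {xs ys nzx yzF yz} => //= b p IHp z /andP[/andP[zb zbF] pF].
rewrite !inE !negb_or => /and3P[yz yb yp].
rewrite IHp ?inE ?negb_or ?yb // andbT /sub_adj zb !inE zbF andbT.
apply/eqP=> /setP/(_ y); rewrite !inE eqxx orbT.
by rewrite (negPf yz) (negPf yb).
Qed.

Lemma spanning_tree_in F :
    F \subset edges G -> connected (spanning_subgraph F) ->
  exists2 T, is_spanning_tree T & T \subset F.
Proof.
move=> FG cF; pose P (T : {set {set G}}) := connected (spanning_subgraph T).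
have [T /minsetP[cT minT] sTF] := @minset_exists _ P F cF.
exists T => //; apply/andP; split; first exact: subset_trans FG.
apply/andP; split=> //; apply: bridge_acyclic => x y /andP[_ xyT].
apply/negP=> /(connected_setD1 cT) cT'.
have := minT _ cT' (subD1set _ _) => /setP/(_ [set x; y]).
by rewrite !inE eqxx xyT.
Qed.

(** * Spanning trees have n - 1 edges *)

(** Root the tree at r and pair every other vertex x with its first edge on the
    way to r. Two vertices cannot share that edge, since it would not be a
    bridge. Every edge uv is used: removing it leaves r connected to one of its
    ends, say v, and u cannot reach r without uv. *)
Lemma card_spanning_tree F : is_spanning_tree F -> #|F|.+1 = #|G|.
Proof.
case/andP=> /subsetP FG /andP[/connected_spanningP[/card_gt0P[r _] cF] acF].
pose P x a := sub_adj F x a && connect (sub_adj [set e in F | x \notin e]) a r.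
pose up x := odflt x [pick a | P x a].
have upP x : x != r -> P x (up x).
  move=> xr; rewrite /up; case: pickP => //= noP.
  have [a xa ar] := connect_first_step xr (cF x r).
  by have := noP a; rewrite /P xa ar.
pose up_edge x := [set x; up x].
have avoid x (f : {set G}) : x \in f -> [set e in F | x \notin e] \subset F :\ f.
  move=> xf; apply/subsetP=> e; rewrite !inE => /andP[eF xe].
  by rewrite eF andbT; apply: contraNneq xe => ->.
have inj_up : {in [set~ r] &, injective up_edge}.
  move=> x y; rewrite !in_setC1 => xr yr xyE.
  have /andP[xa ar] := upP x xr; have /andP[yb br] := upP y yr.
  have [//|nxy] := eqVneq x y.
  have upx : up x = y.
    have : y \in up_edge x by rewrite xyE set21.
    by case/set2P=> // yx; rewrite yx eqxx in nxy.
  have upy : up y = x.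
    have : x \in up_edge y by rewrite -xyE set21.
    by case/set2P=> // yx; rewrite yx eqxx in nxy.
  rewrite upx in xa ar; rewrite upy in br.
  case/negP: (acyclic_bridge acF xa).
  apply: (@connect_trans _ _ r).
    exact: connect_mono (avoid _ _ (set22 x y)) br.
  rewrite connect_sub_adj_sym.
  exact: connect_mono (avoid _ _ (set21 x y)) ar.
have used u v : [set u; v] \in F -> u != v ->
    connect (sub_adj (F :\ [set u; v])) v r ->
  [set u; v] \in up_edge @: [set~ r].
  move=> uvF nuv vr; have uv : sub_adj F u v by rewrite /sub_adj nuv.
  have nur : ~~ connect (sub_adj (F :\ [set u; v])) u r.
    apply: contra (acyclic_bridge acF uv) => ur; apply: connect_trans ur _.
    by rewrite connect_sub_adj_sym.
  have ur : u != r by apply: contraNneq nur => ->.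
  apply/imsetP; exists u; first by rewrite in_setC1.
  have /andP[/andP[ua uaF] ar] := upP u ur.
  apply/eqP; apply: contraNT nur => neq.
  apply: (@connect_trans _ _ (up u)); first apply: connect1.
    by rewrite /sub_adj ua in_setD1 eq_sym neq.
  exact: connect_mono (avoid _ _ (set21 u v)) ar.
have FE : up_edge @: [set~ r] = F.
  apply/setP=> f; apply/idP/idP=> [/imsetP[x] | fF].
    by rewrite in_setC1 => /upP/andP[/andP[_ xF] _] ->.
  have [u [v [uv fE]]] := edgesP (FG f fF); rewrite fE in fF *.
  (* Walking from v to r without returning to v, either the first step is not
     the edge uv, or u reaches r without that edge. *)
  have [vr|vr] := eqVneq v r; first by apply: used; rewrite // vr connect0.
  have [a va ar] := connect_first_step vr (cF v r).
  have {}ar := connect_mono (avoid _ _ (set22 u v)) ar.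
  have [au|nau] := eqVneq [set v; a] [set u; v].
    have: u \in [set v; a] by rewrite au set21.
    case/set2P=> [uE|uE]; first by rewrite uE eqxx in uv.
    by rewrite -uE in ar; rewrite setUC; apply: used; rewrite 1?setUC // eq_sym.
  apply: used => //; apply: connect_trans (connect1 _) ar.
  by case/andP: va => va vaF; rewrite /sub_adj va in_setD1 nau.
by rewrite -FE (card_in_imset inj_up) cardsC1 prednK //; apply/card_gt0P; exists r.
Qed.

Lemma connected_card_spanning_tree F :
    F \subset edges G -> connected (spanning_subgraph F) -> #|F|.+1 = #|G| ->
  is_spanning_tree F.
Proof.
move=> FG cF cardF; have [T tT sTF] := spanning_tree_in FG cF.
suff <- : T = F by [].
apply/eqP; rewrite eqEcard sTF /=.
by have := card_spanning_tree tT; rewrite -cardF => -[->].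
Qed.

(** * Exchanging an edge *)

Lemma exchange_first_edge F x y :
    is_spanning_tree F -> [set x; y] \in edges G :\: F -> x != y ->
  exists a, [/\ a != y, [set x; a] \in F &
    is_spanning_tree (([set x; y] |: F) :\ [set x; a])].
Proof.
move=> tF /setDP[xyG xyF] nxy; have [FG /andP[cF _]] := andP tF.
have [G_gt0 cFxy] := connected_spanningP _ cF.
have [a /andP[xa xaF] ay] := connect_first_step nxy (cFxy x y).
have nay : a != y by apply: contraNneq xyF => <-.
have neq : [set x; y] != [set x; a] by apply: contraNneq xyF => ->.
exists a; split=> //; apply: connected_card_spanning_tree.
- apply: subset_trans (subD1set _ _) _.
  by rewrite subUset sub1set xyG.
- apply: connected_setD1.
    apply/connected_spanningP; split=> // u v.
    exact: connect_mono (subsetUr _ _) (cFxy u v).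
  apply: (@connect_trans _ _ y).
    by apply: connect1; rewrite /sub_adj nxy !inE neq eqxx.
  rewrite connect_sub_adj_sym; apply: connect_mono _ ay.
  apply/subsetP=> e; rewrite !inE => /andP[eF xe]; rewrite eF orbT andbT.
  by apply: contraNneq xe => ->; rewrite set21.
- have := cardsD1 [set x; a] ([set x; y] |: F).
  rewrite cardsU1 xyF !inE xaF orbT /= !add1n => -[<-].
  exact: card_spanning_tree.
Qed.

(** The edge removed at x misses y, so it differs from the one removed at y, and
    the two exchanges produce different trees. *)
Lemma unit_transformations_ge2 (S : Aux G) e :
    e \in edges G :\: val S ->
  2 <= #|[set T : Aux G | adj S T & e \in val T]|.
Proof.
move=> eD; have [eG eS] := setDP eD; have [x [y [nxy eE]]] := edgesP eG.
have tS : is_spanning_tree (val S) := valP S.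
have [a [nay xaS tT]] : exists a, [/\ a != y, [set x; a] \in val S &
    is_spanning_tree ((e |: val S) :\ [set x; a])].
  by rewrite eE; apply: exchange_first_edge; rewrite -?eE.
have [b [nbx ybS tU]] : exists b, [/\ b != x, [set y; b] \in val S &
    is_spanning_tree ((e |: val S) :\ [set y; b])].
  have eE' : e = [set y; x] by rewrite setUC.
  by rewrite eE'; apply: exchange_first_edge; rewrite -?eE' // eq_sym.
pose tree F (tF : is_spanning_tree F) : Aux G := exist _ F tF.
  have exch f (tf : is_spanning_tree ((e |: val S) :\ f)) : f \in val S ->
    tree _ tf \in [set T : Aux G | adj S T & e \in val T].
  move=> fS; rewrite inE /=; apply/andP; split.
    by apply/exists_inP; exists e => //; apply/exists_inP; exists f.
  by rewrite !inE eqxx andbT; apply: contraNneq eS => ->.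
have neq : [set x; a] != [set y; b].
  apply/eqP=> /setP/(_ y); rewrite !inE eqxx eq_sym.
  by rewrite (negPf nxy) eq_sym (negPf nay).
have nTU : tree _ tT != tree _ tU.
  apply/eqP=> /(congr1 val)/setP/(_ [set x; a]).
  by rewrite !inE eqxx neq xaS orbT.
rewrite -[2]/(true.+1) -nTU -cards2; apply/subset_leq_card/subsetP=> T.
by case/set2P=> ->; apply: exch.
Qed.

(** Double counting of the pairs (e, T) with T a neighbour of S and e an edge of
    T outside S: each e has at least two T, each T has only one e. *)
Lemma aux_degree_ge (S : Aux G) : 2 * #|edges G :\: val S| <= degree S.
Proof.
apply: (@leq_trans (\sum_(e in edges G :\: val S)
    \sum_(T in [set T : Aux G | adj S T]) (e \in val T))).
  rewrite mulnC -sum_nat_const; apply: leq_sum => e /unit_transformations_ge2.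
  move/leq_trans; apply; rewrite -sum1_card [leqLHS]big_mkcond [leqRHS]big_mkcond /=.
  by apply: leq_sum => T _; rewrite !inE; case: (aux_adj _ _) (e \in _) => -[].
rewrite exchange_big /= /degree -sum1_card; apply: leq_sum => T.
rewrite inE => /exists_inP[e _ /exists_inP[f _ /eqP TE]].
rewrite -big_mkcondr /= sum1_card.
rewrite -(cards1 e); apply/subset_leq_card/subsetP=> g.
rewrite inE => /andP[/setDP[_ gS]].
by rewrite TE !inE (negPf gS) orbF => /andP[].
Qed.

End EdgeSets.

(** The vertex x0 bounds k by the number of vertices, which is the default value
    of the minimum. *)
Lemma min_degree_ge (H : sgraph) (x0 : H) k :
  (forall x : H, k <= degree x)%N -> (k <= min_degree H)%N.
Proof.
move=> deg_ge; rewrite /min_degree; elim/big_ind: _ => //.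
  exact: leq_trans (deg_ge x0) (max_card _).
by move=> m n km kn; rewrite leq_min km.
Qed.

Theorem lemma11 (G : sgraph) (hG : connected G) :
  (min_degree (Aux G))%:Z >= 2 * (#|edges G|%:Z - #|G|%:Z + 1).
Proof.
have [F tF _] := spanning_tree_in (subxx _) (connected_edges hG).
pose k := (#|edges G|.+1 - #|G|)%N.
have : (2 * k <= min_degree (Aux G))%N.
  apply: (@min_degree_ge (Aux G) (exist _ F tF)) => S.
  apply: leq_trans (aux_degree_ge S).
  have tS : is_spanning_tree (val S) := valP S.
  have [SG _] := andP tS.
  by rewrite /k -(card_spanning_tree tS) subSS cardsD (setIidPr SG).
by rewrite /k; lia.
Qed.
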